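(* Let $X$ be a real Banach space, let $(Z_i)_{i\in I}$ be a collection of strictly convex real Banach spaces indexed by an arbitrary set $I$, let $Z$ be the $\ell_1$-sum of the collection $(Z_i)_{i\in I}$, and let $F\colon B_X \to B_Z$ be a non-expansive bijection. Then $F$ is an isometry, i.e. $\|F(x)-F(y)\|=\|x-y\|$ for all $x,y\in B_X$.
   Context: All Banach spaces are real. For a Banach space $E$, $S_E$ and $B_E$ denote its unit sphere and closed unit ball. A map $F\colon U\to V$ between metric spaces is non-expansive if $\rho(F(u_1),F(u_2))\le \rho(u_1,u_2)$ for all $u_1,u_2\in U$; the balls carry the metric induced by the norm. A Banach space $E$ is strictly convex if every point of $S_E$ is an extreme point of $B_E$. The $\ell_1$-sum $Z$ of $(Z_i)_{i\in I}$ is the space of all families $z=(z_i)_{i\in I}$ with $z_i\in Z_i$, with at most countable support $\{i\in I: z_i\ne 0\}$, and with $\sum_{i\in I}\|z_i\|_{Z_i}<\infty$, equipped with the norm $\|z\|=\sum_{i\in I}\|z_i\|_{Z_i}$. The index set $I$ may be finite, countable or uncountable. *)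

(* Defs.v *)
From HB Require Import structures.
From mathcomp Require Import all_boot all_order all_algebra.
From mathcomp Require Import all_classical all_reals all_analysis.

Set Implicit Arguments.
Unset Strict Implicit.
Unset Printing Implicit Defensive.

Import Order.TTheory GRing.Theory Num.Theory.
Import numFieldNormedType.Exports.

Local Open Scope classical_set_scope.
Local Open Scope ring_scope.

Definition unit_sphere (R : realType) (E : normedModType R) : set E :=
  [set x | `|x| = 1].

Definition unit_ball (R : realType) (E : normedModType R) : set E :=
  [set x | `|x| <= 1].

Arguments unit_sphere {R} E.
Arguments unit_ball {R} E.

Definition extreme_point (R : realType) (E : lmodType R) (A : set E) (x : E) :
    Prop :=
  A x /\ forall (y z : E) (t : R), A y -> A z -> 0 < t < 1 ->
    x = t *: y + (1 - t) *: z -> y = x /\ z = x.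

Definition strictly_convex (R : realType) (E : normedModType R) : Prop :=
  forall x : E, unit_sphere E x -> extreme_point (unit_ball E) x.

Definition nonexpansive_on (R : realType) (U V : normedModType R) (A : set U)
    (f : U -> V) : Prop :=
  forall x y : U, A x -> A y -> `|f x - f y| <= `|x - y|.

Section l1sum.
Context {R : realType} {I : choiceType}.
Variable Z : I -> normedModType R.

(* Countability of the support already follows from summability; it is kept
   because the l1-sum is customarily defined with both conditions. *)
Definition l1summable (z : forall i, Z i) : Prop :=
  countable [set i | z i != 0] /\ summable [set: I] (fun i => `|z i|%:E).

Record l1sum := L1Sum {
  l1fun :> forall i, Z i;
  l1funP : l1summable l1fun
}.

HB.instance Definition _ := gen_eqMixin l1sum.
HB.instance Definition _ := gen_choiceMixin l1sum.

Lemma l1sumP (u v : l1sum) : (forall i, u i = v i) -> u = v.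
Proof.
case: u v => [u Pu] [v Pv] /= uv.
have {}uv : u = v by apply: functional_extensionality_dep.
by subst v; congr L1Sum; exact: Prop_irrelevance.
Qed.

Let finlt (z : forall i, Z i) :
  summable [set: I] (fun i => `|z i|%:E) =
  (\esum_(i in [set: I]) `|z i|%:E < +oo)%E.
Proof. by congr (_ < _)%E; apply: eq_esum => i _; rewrite abse_EFin normr_id. Qed.

Let l1summable0 : l1summable (fun=> 0).
Proof.
split.
  by rewrite (_ : [set _ | _] = set0) // -subset0 => i /=; rewrite eqxx.
by rewrite finlt esum1 ?ltry// => i _; rewrite normr0.
Qed.

Let l1summableN (u : l1sum) : l1summable (fun i => - u i).
Proof.
case: (l1funP u) => cu su; split.
  by apply: sub_countable cu; apply: subset_card_le => i /=; rewrite oppr_eq0.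
by move: su; rewrite !finlt; under eq_esum do rewrite -normrN.
Qed.

Let l1summableD (u v : l1sum) : l1summable (fun i => u i + v i).
Proof.
case: (l1funP u) (l1funP v) => cu su [cv sv]; split.
  have : countable ([set i | u i != 0] `|` [set i | v i != 0]).
    by rewrite -bigcup2E; apply: bigcup_countable => // -[|[|n]] _ /=.
  apply: sub_countable; apply: subset_card_le.
  move=> i /=; have [->|] := eqVneq (u i) 0; last by left.
  by rewrite add0r; right.
move: su sv; rewrite !finlt => su sv.
apply: le_lt_trans (lte_add_pinfty su sv).
by rewrite -esumD//; apply: le_esum => i _; rewrite -EFinD lee_fin ler_normD.
Qed.

Let esum_scale (a : R) (f : I -> R) : (forall i, 0 <= f i) -> 0 <= a ->
  (\esum_(i in [set: I]) (a * f i)%:E <=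
   a%:E * \esum_(i in [set: I]) (f i)%:E)%E.
Proof.
move=> f0 a0; apply: ge_ereal_sup => _ [X [finX XI] <-].
rewrite (_ : (\sum_(x \in X) (a * f x)%:E =
    a%:E * \sum_(x \in X) (f x)%:E)%E); last first.
  by rewrite !fsbig_finite//= ge0_sume_distrr// => i _; rewrite lee_fin.
by apply: lee_wpmul2l; [rewrite lee_fin|apply: esum_ge; exists X].
Qed.

Let l1summableZ (a : R) (u : l1sum) : l1summable (fun i => a *: u i).
Proof.
case: (l1funP u) => cu su; split.
  apply: sub_countable cu; apply: subset_card_le => i /=.
  by rewrite scaler_eq0 negb_or => /andP[].
move: su; rewrite !finlt => su.
under eq_esum do rewrite normrZ.
apply: le_lt_trans (esum_scale _ _) _ => //.
by rewrite lte_mul_pinfty// lee_fin.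
Qed.

Let add0 := L1Sum l1summable0.
Let opp u := L1Sum (l1summableN u).
Let add u v := L1Sum (l1summableD u v).
Let scale a u := L1Sum (l1summableZ a u).

Let addA : associative add.
Proof. by move=> u v w; apply: l1sumP => i /=; rewrite addrA. Qed.
Let addC : commutative add.
Proof. by move=> u v; apply: l1sumP => i /=; rewrite addrC. Qed.
Let add0l : left_id add0 add.
Proof. by move=> u; apply: l1sumP => i /=; rewrite add0r. Qed.
Let addNl : left_inverse add0 opp add.
Proof. by move=> u; apply: l1sumP => i /=; rewrite addNr. Qed.

HB.instance Definition _ := GRing.isZmodule.Build l1sum addA addC add0l addNl.

Let scaleA a b u : scale a (scale b u) = scale (a * b) u.
Proof. by apply: l1sumP => i /=; rewrite scalerA. Qed.
Let scale1 : left_id 1 scale.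
Proof. by move=> u; apply: l1sumP => i /=; rewrite scale1r. Qed.
Let scaleDr : right_distributive scale +%R.
Proof. by move=> a u v; apply: l1sumP => i /=; rewrite scalerDr. Qed.
Let scaleDl u : {morph scale^~ u : a b / a + b}.
Proof. by move=> a b; apply: l1sumP => i /=; rewrite scalerDl. Qed.

HB.instance Definition _ :=
  GRing.Zmodule_isLmodule.Build R l1sum scaleA scale1 scaleDr scaleDl.

Definition l1norm (u : l1sum) : R :=
  fine (\esum_(i in [set: I]) `|u i|%:E).

Let l1normE (u : l1sum) : (l1norm u)%:E = (\esum_(i in [set: I]) `|u i|%:E)%E.
Proof.
rewrite /l1norm fineK// ge0_fin_numE; last by apply: esum_ge0 => i _; rewrite lee_fin.
by rewrite -finlt; case: (l1funP u).
Qed.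

Let l1norm_triangle u v : l1norm (u + v) <= l1norm u + l1norm v.
Proof.
rewrite -lee_fin EFinD !l1normE -esumD//.
by apply: le_esum => i _; rewrite -EFinD lee_fin ler_normD.
Qed.

Let l1normZ_le a u : l1norm (a *: u) <= `|a| * l1norm u.
Proof.
rewrite -lee_fin EFinM !l1normE; apply: le_trans (esum_scale _ _) => //.
by apply: le_esum => i _; rewrite lee_fin normrZ.
Qed.

Let l1normZ (a : R) u : l1norm (a *: u) = `|a| * l1norm u.
Proof.
apply/eqP; rewrite eq_le l1normZ_le/=.
have [->|a0] := eqVneq a 0.
  by rewrite normr0 mul0r -lee_fin l1normE esum_ge0// => i _; rewrite lee_fin.
rewrite -ler_pdivlMl ?normr_gt0// -normfV -[in leLHS](scalerK a0 u).
exact: l1normZ_le.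
Qed.

Let l1norm0 u : l1norm u = 0 -> u = 0.
Proof.
move=> u0; apply: l1sumP => i /=; apply/eqP; rewrite -normr_le0 -lee_fin.
rewrite -u0 l1normE -(@esum_set1 _ _ i (fun i => `|u i|%:E)) ?lee_fin//.
rewrite esum_mkcond; apply: le_esum => j _.
by case: ifP => // _; rewrite lee_fin.
Qed.

HB.instance Definition _ :=
  @Lmodule_isNormed.Build R l1sum l1norm l1norm_triangle l1normZ l1norm0.

End l1sum.

(* Main.v *)
Require Import Defs.
From mathcomp Require Import all_boot all_order all_algebra.
From mathcomp Require Import all_classical all_reals all_analysis.
From mathcomp Require Import ring lra.
Import Order.TTheory GRing.Theory Num.Theory.
Import numFieldNormedType.Exports.
Local Open Scope classical_set_scope.
Local Open Scope ring_scope.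

(** The statement that [F] is an isometry reduces to a statement about its
    inverse [G] on the unit ball of the sum: it suffices that [G] is
    homogeneous and does not increase the norm.  Indeed, for a homogeneous,
    norm-preserving, non-expansive [H] and [w = x - t y], the triangle
    inequality applied to [H((M+1)w) + H(Mw)] with large [M] bounds
    [|H x - t H y|] from below by [|w|] minus [t] times a second difference
    quotient of [t |-> |x - t y|].  For suitable [t] near [1] that
    quotient is arbitrarily small, since a Lipschitz function cannot bend much
    at every point of a grid ([homogeneous_nonexpansive_isometry]).

    Homogeneity of [G] is obtained in four stages.

    - One summand.  A unit vector [e] of a single summand [Z_i] is an extreme
      point of the ball of the sum, so that [F] has to map the segment from [0]
      to [G e] onto the one from [0] to [e] isometrically; the midpoint of [G e]
      and [G (-e)] goes to [0], whence [G (-e) = - G e] ([F_unit]).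

    - Two summands.  Comparing the distances of [F (a G e + b G f)] to [a e] and
      to [b f] shows that it equals [(a - c) e + (b - c) f] for some [c >= 0]
      ([pair_shrink]).  The images of the combinations [a G e + b G f] cover a
      neighbourhood of [0] in the quadrant spanned by [e] and [f], by a
      one-dimensional intermediate value argument on each diagonal
      ([pair_fill]).  For [z] on the unit sphere of this quadrant and [d] small,
      the image of [d G z] is therefore also the image of a combination of
      [G e] and [G f]; by injectivity [G z] is such a combination itself, and
      there is no room left for [c > 0] ([pair_sphere], [pair_identity]).

    - Finitely many summands, by induction ([F_Gsum]).  With [z_k] the
      component of [z] in the [k]-th summand, [v = F (sum_k G z_k)] lies within
      [|z_k|] of [z - z_k] by the induction hypothesis, which gives
      [|v - z| <= 2 |v_k - z_k|] for every [k].  Three different indices add up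
      to [3 |v - z| <= 2 |v - z|], hence [v = z].

    - Arbitrary vectors.  The sums of [G z_k] over finite sets of indices
      form a Cauchy net because [|G z_k| <= |z_k|] is summable; as [X] is
      complete it converges, necessarily to [G z] ([G_homogeneous]). *)

Set Implicit Arguments.
Unset Strict Implicit.
Unset Printing Implicit Defensive.

(** * Strict convexity *)

(** Equality in the triangle inequality [|u| <= |v| + |u - v|] makes the unit
    vector of [u] a convex combination of those of [v] and [u - v], and
    extremality identifies the three. *)
Lemma strictly_convex_between (R : realType) (E : normedModType R) (u v : E) :
  strictly_convex E -> `|v| + `|u - v| <= `|u| -> `|u| *: v = `|v| *: u.
Proof.
move=> scE vu.
have [->|v0] := eqVneq v 0; first by rewrite normr0 scaler0 scale0r.
have [uv|uv] := eqVneq (u - v) 0.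
  by move/eqP: uv; rewrite subr_eq0 => /eqP ->.
have {vu}uE : `|u| = `|v| + `|u - v|.
  apply/eqP; rewrite eq_le vu andbT; apply: le_trans (ler_normD _ _).
  by rewrite addrC subrK.
have nv : 0 < `|v| by rewrite normr_gt0.
have nuv : 0 < `|u - v| by rewrite normr_gt0.
have nu : 0 < `|u| by lra.
have unit (x : E) : x != 0 -> `|(`|x|^-1 *: x)| = 1.
  by move=> x0; rewrite normrZ normfV normr_id mulVf// normr_eq0.
have u0 : u != 0 by rewrite -normr_gt0.
have [_ ext] := scE (`|u|^-1 *: u) (unit _ u0).
have [||||vE _] := ext (`|v|^-1 *: v) (`|u - v|^-1 *: (u - v)) (`|v| / `|u|).
- by rewrite /unit_ball/= unit.
- by rewrite /unit_ball/= unit.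
- by rewrite divr_gt0//= ltr_pdivrMr// mul1r; lra.
- rewrite (_ : 1 - _ = `|u - v| / `|u|).
    rewrite !scalerA ![_ / `|u| * _]mulrAC !divff ?gt_eqF// !mul1r -scalerDr.
    by rewrite addrC subrK.
  by rewrite uE; field; rewrite -uE gt_eqF.
have -> : `|u| *: v = (`|u| * `|v|) *: (`|v|^-1 *: v).
  by rewrite scalerA mulfK// gt_eqF.
by rewrite vE scalerA [`|u| * _]mulrC mulfK// gt_eqF.
Qed.

Lemma strictly_convex_ray (R : realType) (E : normedModType R) (e v : E)
    (a : R) :
  strictly_convex E -> `|e| = 1 -> 0 <= a -> `|v| + `|v - a *: e| <= a ->
  v = `|v| *: e.
Proof.
move=> scE e1 a0 va.
have nae : `|a *: e| = a by rewrite normrZ e1 mulr1 ger0_norm.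
have := @strictly_convex_between _ _ (a *: e) v scE.
rewrite nae distrC => /(_ va); rewrite scalerA.
have [a_eq0 _|an0] := eqVneq a 0; last first.
  by rewrite mulrC -scalerA => /(scalerI an0).
have -> : v = 0.
  apply: normr0_eq0; have := normr_ge0 (v - a *: e).
  by have := normr_ge0 v; lra.
by rewrite normr0 scale0r.
Qed.

Lemma unit_triangle (R : realType) (E : normedModType R) (e v : E) (a : R) :
  `|e| = 1 -> 0 <= a -> a <= `|v| + `|v - a *: e|.
Proof.
move=> e1 a0; have {1}-> : a = `|a *: e| by rewrite normrZ e1 mulr1 ger0_norm.
by rewrite addrC distrC; apply: le_trans (ler_normD _ _); rewrite subrK.
Qed.

(** * The norm of an l1-sum *)

Section L1Norm.
Context {R : realType} {I : choiceType} {Z : I -> normedModType R}.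
Implicit Types u v w z : l1sum Z.

Lemma l1normE z : (`|z|%:E = \esum_(i in [set: I]) `|z i|%:E)%E.
Proof.
have fin : (\esum_(i in [set: I]) `|z i|%:E < +oo)%E.
  have [_] := l1funP z; rewrite /summable; congr (_ < _)%E.
  by apply: eq_esum => i _; rewrite abse_EFin normr_id.
rewrite [`|z|]/(l1norm z) /l1norm fineK// ge0_fin_numE//.
by apply: esum_ge0 => i _; rewrite lee_fin.
Qed.

Lemma l1norm_add u v w : (forall i, `|w i| = `|u i| + `|v i|) ->
  `|w| = `|u| + `|v|.
Proof.
move=> wuv; apply: EFin_inj; rewrite EFinD !l1normE -esumD//.
by apply: eq_esum => i _; rewrite wuv.
Qed.

Lemma l1norm_single i z : (forall j, j != i -> z j = 0) -> `|z| = `|z i|.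
Proof.
move=> zi; apply: EFin_inj; rewrite l1normE.
rewrite -(@esum_set1 _ _ i (fun i => `|z i|%:E)) ?lee_fin// [RHS]esum_mkcond.
apply: eq_esum => j _; rewrite in_set1.
by case: ifPn => // /zi ->; rewrite normr0.
Qed.

Lemma restriction_l1summable (A : pred I) z :
  l1summable (fun i => if A i then z i else 0).
Proof.
have [cz sz] := l1funP z; split.
  apply: sub_countable cz; apply: subset_card_le => i /=.
  by case: ifP => //; rewrite eqxx.
apply: le_lt_trans sz; apply: le_esum => i _; rewrite !abse_EFin lee_fin.
by case: ifP => // _; rewrite normr0 normr0 normr_ge0.
Qed.

Definition restriction (A : pred I) z : l1sum Z :=
  L1Sum (restriction_l1summable A z).

Lemma l1funD u v i : (u + v) i = u i + v i. Proof. by []. Qed.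
Lemma l1funN u i : (- u) i = - u i. Proof. by []. Qed.
Lemma l1funZ a u i : (a *: u) i = a *: u i. Proof. by []. Qed.
Lemma restrictionE A z i : restriction A z i = if A i then z i else 0.
Proof. by []. Qed.

Lemma l1norm_restriction A z :
  `|z| = `|restriction A z| + `|restriction (predC A) z|.
Proof.
by apply: l1norm_add => i; rewrite !restrictionE /=; case: ifP => _;
  rewrite normr0 ?addr0 ?add0r.
Qed.

(** The sum of the norms of the components is the supremum of its finite partial
    sums. *)
Lemma finite_restriction_dense z e : 0 < e ->
  exists2 J : seq I, uniq J & `|z - restriction (mem J) z| < e.
Proof.
move=> e0.
have : (`|z|%:E - e%:E < \esum_(i in [set: I]) `|z i|%:E)%E.
  by rewrite -l1normE -EFinB lte_fin ltrBlDr ltrDl.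
rewrite /esum => /ereal_sup_gt[_ [J [finJ _] <-]].
rewrite -esum_fset// esum_mkcond => Jbig.
pose s : seq I := finmap.enum_fset (fset_set J).
exists s; first exact: finmap.fset_uniq.
have -> : z - restriction (mem s) z = restriction (predC (mem s)) z.
  apply: l1sumP => i; rewrite l1funD l1funN !restrictionE /=.
  by case: ifP; rewrite /= ?subrr ?subr0.
rewrite -(ltrD2l `|restriction (mem s) z|) -l1norm_restriction -ltrBlDr.
rewrite -lte_fin EFinB; apply: lt_le_trans Jbig _.
rewrite l1normE; apply: le_esum => i _; rewrite restrictionE /= in_fset_set//.
by case: ifP => //; rewrite normr0.
Qed.

Lemma l1norm_restriction_le A z : `|restriction A z| <= `|z|.
Proof. by rewrite (l1norm_restriction A z) lerDl. Qed.

Lemma l1norm_coord i z :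
  `|z| = `|z i| + `|restriction (predC1 i) z|.
Proof.
rewrite (l1norm_restriction (pred1 i)) (@l1norm_single i).
  by rewrite restrictionE /= eqxx.
by move=> j ji; rewrite restrictionE /= (negPf ji).
Qed.

Lemma restrictionB A u v :
  restriction A (u - v) = restriction A u - restriction A v.
Proof.
apply: l1sumP => i; rewrite l1funD l1funN !restrictionE.
by case: ifP => _ //; rewrite subrr.
Qed.

(** The norm is the sum of the norms of the components, each of which satisfies
    the reverse inequality; equality in total forces it in every component. *)
Lemma l1norm_between_coord v z : `|v| + `|z - v| <= `|z| ->
  forall i, `|v i| + `|z i - v i| <= `|z i|.
Proof.
move=> vz i; move: vz; rewrite (l1norm_coord i v) (l1norm_coord i (z - v)).
rewrite (l1norm_coord i z) restrictionB.
have : `|restriction (predC1 i) z| <= `|restriction (predC1 i) v| +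
    `|restriction (predC1 i) z - restriction (predC1 i) v|.
  by apply: le_trans (ler_normD _ _); rewrite addrC subrK.
rewrite l1funD l1funN; lra.
Qed.

Definition supported_at i z := forall j, j != i -> z j = 0.

(** This is the extremality, in the ball of the sum, of the unit vectors of a
    single summand: the components of [v] away from [i] vanish since those of
    [z] do, and strict convexity of [Z i] settles the remaining one. *)
Lemma l1norm_segment (Zsc : forall i, strictly_convex (Z i)) i z v :
  supported_at i z -> `|v| + `|z - v| <= `|z| -> `|z| *: v = `|v| *: z.
Proof.
move=> zi /l1norm_between_coord vz.
have vi : supported_at i v.
  move=> j ji; apply: normr0_eq0; have := vz j; rewrite zi// normr0.
  have := normr_ge0 (0 - v j); have := normr_ge0 (v j); lra.
apply: l1sumP => j; rewrite !l1funZ (l1norm_single zi) (l1norm_single vi).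
have [->|ji] := eqVneq j i; first exact: strictly_convex_between.
by rewrite (zi j ji) (vi j ji) !scaler0.
Qed.

Lemma supported_atZ i a z : supported_at i z -> supported_at i (a *: z).
Proof. by move=> zi j ji; rewrite l1funZ zi// scaler0. Qed.

Lemma supported_at_unit i u : supported_at i u -> u != 0 ->
  exists e, [/\ supported_at i e, `|e| = 1 & u = `|u| *: e].
Proof.
move=> ui u0; exists (`|u|^-1 *: u); split.
- exact: supported_atZ.
- by rewrite normrZ normfV normr_id mulVf ?normr_eq0.
- by rewrite scalerA mulfV ?scale1r ?normr_eq0.
Qed.

Lemma l1norm_coord2 i j z : i != j ->
  `|z| = `|z i| + `|z j| + `|restriction [pred k | (k != i) && (k != j)] z|.
Proof.
move=> ij; rewrite (l1norm_coord i z) (l1norm_coord j) restrictionE /=.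
rewrite eq_sym ij.
rewrite addrA; congr (_ + `|_|); apply: l1sumP => k.
by rewrite !restrictionE /= andbC; case: (k != j).
Qed.

Lemma l1norm_ge_coord i z : `|z i| <= `|z|.
Proof. by rewrite (l1norm_coord i) lerDl. Qed.

Lemma l1norm_ge_sum (J : seq I) z : uniq J ->
  \sum_(i <- J) `|z i| <= `|z|.
Proof.
elim: J z => [|i J IH] z /=; first by rewrite big_nil.
move=> /andP[iJ uJ]; rewrite big_cons (l1norm_coord i z) lerD2l.
apply: le_trans (IH (restriction (predC1 i) z) uJ).
rewrite (@eq_big_seq _ _ _ _ _ _ (fun j => `|restriction (predC1 i) z j|))//.
move=> j jJ; rewrite restrictionE /=; case: eqP => // ji.
by rewrite -ji jJ in iJ.
Qed.

Definition part i z : l1sum Z := restriction (pred1 i) z.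

Lemma part_supported_at i z : supported_at i (part i z).
Proof. by move=> j ji; rewrite /part restrictionE /= (negPf ji). Qed.

Lemma l1norm_part i z : `|part i z| = `|z i|.
Proof.
by rewrite (l1norm_single (@part_supported_at i z)) restrictionE /= eqxx.
Qed.

Lemma part_le1 i z : `|z| <= 1 -> `|part i z| <= 1.
Proof. by rewrite l1norm_part; apply: le_trans; exact: l1norm_ge_coord. Qed.

Lemma partZ a i z : part i (a *: z) = a *: part i z.
Proof.
apply: l1sumP => j; rewrite l1funZ !restrictionE l1funZ.
by case: ifP => //; rewrite scaler0.
Qed.

End L1Norm.

(** * Homogeneous non-expansive maps *)

(** The second differences along a grid of step [h] telescope to the difference
    of two increments of [phi], each at most [L * h] in absolute value; the
    smallest of [K + 1] of them is at most the average. *)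
Lemma small_second_difference (R : realType) (phi : R -> R) (L a h : R)
    (K : nat) :
  (forall s t, `|phi s - phi t| <= L * `|s - t|) -> 0 < h ->
  exists2 j : nat, (j <= K)%N &
    let t := a + j.+1%:R * h in
    phi (t + h) + phi (t - h) - phi t *+ 2 <= (L * h *+ 2) / K.+1%:R.
Proof.
move=> phiL h0; apply/not_exists2P => noj.
set c := (L * h *+ 2) / K.+1%:R.
pose s (n : nat) := a + n%:R * h.
have sS n : s n.+1 = s n + h by rewrite /s -addn1 natrD; ring.
have step n : (n <= K)%N ->
    phi (s n.+1) - phi (s n) + c < phi (s n.+2) - phi (s n.+1).
  move=> nK; have [//|] := noj n.
  move=> /negP; rewrite -ltNge -/c -/(s n.+1) -sS.
  rewrite (_ : s n.+1 - h = s n); last by rewrite sS addrK.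
  lra.
have incr n : (n <= K)%N ->
    phi (s 1) - phi (s 0) + n.+1%:R * c < phi (s n.+2) - phi (s n.+1).
  elim: n => [|n IH] nK; first by rewrite mul1r; exact: step.
  apply: le_lt_trans (step _ nK).
  have /ltW := IH (ltnW nK).
  rewrite -[n.+2]addn1 natrD; lra.
have := incr K (leqnn _).
rewrite [_%:R * c]mulrC divfK ?pnatr_eq0//.
have hE n : `|s n.+1 - s n| = h by rewrite sS addrAC subrr add0r gtr0_norm.
have := phiL (s 1) (s 0); have := phiL (s K.+2) (s K.+1).
rewrite !hE !ler_norml => /andP[_ ?] /andP[? _].
lra.
Qed.

(** Second differences of [phi t = |x - t y|] replace the usual argument with
    support functionals at points of differentiability of the norm. *)
Lemma homogeneous_nonexpansive_isometry (R : realType) (X Y : normedModType R)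
    (H : X -> Y) :
  (forall a x, H (a *: x) = a *: H x) -> (forall x, `|H x| = `|x|) ->
  (forall x y, `|H x - H y| <= `|x - y|) ->
  forall x y, `|H x - H y| = `|x - y|.
Proof.
move=> HZ Hnorm Hle x y; apply/eqP; rewrite eq_le Hle/=.
pose phi t := `|x - t *: y|.
have phiL s t : `|phi s - phi t| <= `|y| * `|s - t|.
  apply: le_trans (ler_dist_dist _ _) _.
  rewrite opprB addrC addrA subrK -scalerBl normrZ mulrC distrC//.
(* With [w = x - t y] and [M = t / h] one has
   [(M+1) w - x = M (x - (t+h) y)] and [M w + t y = M (x - (t-h) y)], while
   [(M+1) w] and [M w] are parallel, so that their images add up to a vector
   of norm [(2M+1) |w|]. *)
have key t h : 0 < t -> 0 < h ->
    phi t - (t / h) * (phi (t + h) + phi (t - h) - phi t *+ 2)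
      <= `|H x - t *: H y|.
  move=> t0 h0; set M := t / h; set w := x - t *: y.
  have M0 : 0 < M by rewrite divr_gt0.
  have Hx : `|H ((M + 1) *: w) - H x| <= M * phi (t + h).
    apply: le_trans (Hle _ _) _.
    rewrite (_ : _ - x = M *: (x - (t + h) *: y)).
      by rewrite normrZ gtr0_norm// lexx.
    rewrite /w !scalerBr !scalerA (_ : M * (t + h) = (M + 1) * t).
      by rewrite [(M + 1) *: x]scalerDl scale1r addrAC addrK.
    by rewrite /M; field; rewrite gt_eqF.
  have Hy : `|H (M *: w) + H (t *: y)| <= M * phi (t - h).
    rewrite -[H (t *: y)]opprK -[- H _]scaleN1r -HZ.
    apply: le_trans (Hle _ _) _.
    rewrite scaleN1r opprK (_ : _ + _ = M *: (x - (t - h) *: y)).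
      by rewrite normrZ gtr0_norm// lexx.
    rewrite /w !scalerBr !scalerA (_ : M * (t - h) = M * t - t).
      by rewrite scalerBl opprB addrA addrAC.
    by rewrite /M; field; rewrite gt_eqF.
  have Hw : (M *+ 2 + 1) * phi t <= `|H ((M + 1) *: w) + H (M *: w)|.
    rewrite !HZ -scalerDl normrZ Hnorm ger0_norm.
      by rewrite mulr2n addrAC lexx.
    by rewrite addr_ge0 ?addr_ge0 ?ltW.
  have : `|H ((M + 1) *: w) + H (M *: w)| <=
      `|H ((M + 1) *: w) - H x| + `|H (M *: w) + H (t *: y)|
      + `|H x - t *: H y|.
    rewrite -[t *: H y]HZ; set p := H (_ *: w); set q := H (M *: w).
    set r := H x; set s := H (t *: y).
    have -> : p + q = (p - r) + (q + s) + (r - s).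
      by rewrite addrACA subrK addrK.
    by apply: le_trans (ler_normD _ _) _; rewrite lerD2r ler_normD.
  lra.
apply/ler_addgt0Pr => e e0.
have L0 := normr_ge0 y.
set L := `|y| in L0 *.
(* The step [h] keeps the whole grid within [c] of [1], so that replacing [t] by
   [1] costs at most [e / 4] on each side; [K] makes the second difference
   quotient at most [e / 4], hence [e / 2] after multiplication by [t <= 2]. *)
pose K := Num.truncn (8 * L / e).
have K0 : 0 < K.+1%:R :> R by rewrite ltr0n.
have KL : 8 * L <= e * K.+1%:R.
  rewrite mulrC [e * _]mulrC -ler_pdivrMr// [L * 8]mulrC ltW//.
  exact: truncnS_gt.
pose c := e / (4 * L + e).
have d0 : 0 < 4 * L + e by lra.
have c0 : 0 < c by rewrite divr_gt0.
have c1 : c <= 1 by rewrite ler_pdivrMr//; lra.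
have cL : c * L * 4 <= e.
  by rewrite /c mulrAC -mulrA mulrAC ler_pdivrMr// ler_pM2l//; lra.
pose h := c / K.+1%:R.
have h0 : 0 < h by rewrite divr_gt0.
have [j jK /=] := small_second_difference 1 K phiL h0.
set t := 1 + _; set D := phi _ + _ - _ => DK.
have tc : t <= 1 + c.
  rewrite lerD2l mulrC mulrAC ler_pdivrMr// ler_pM2l// ler_nat.
  by rewrite ltnS.
have t1 : 1 <= t by rewrite lerDl mulr_ge0// ltW.
have := key t h (lt_le_trans ltr01 t1) h0; rewrite -/D => keyt.
have MD : (t / h) * D <= e / 2.
  have -> : t / h * D = t * (D / h) by ring.
  have Dh : D / h <= e / 4.
    rewrite ler_pdivrMr//; apply: le_trans DK _.
    rewrite ler_pdivrMr// -/L.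
    have -> : e / 4 * h * K.+1%:R = (e * K.+1%:R) * h / 4 by ring.
    by have := ler_wpM2r (ltW h0) KL; lra.
  apply: le_trans (ler_wpM2l _ Dh) _; first by lra.
  have : t * e <= 2 * e by rewrite ler_pM2r//; lra.
  lra.
have tL : L * `|1 - t| <= e / 4.
  have : L * (t - 1) <= L * c by rewrite ler_wpM2l//; lra.
  rewrite ler0_norm ?subr_le0// opprB; lra.
have := phiL 1 t; rewrite -/L ler_norml => /andP[_ phi1t].
have : `|H x - t *: H y| <= `|H x - H y| + L * `|1 - t|.
  have -> : L * `|1 - t| = `|(1 - t) *: H y| by rewrite normrZ Hnorm mulrC.
  by apply: le_trans (ler_normD _ _); rewrite scalerBl scale1r addrA subrK.
have -> : `|x - y| = phi 1 by rewrite /phi scale1r.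
lra.
Qed.

(** A map that is homogeneous on the ball extends to a homogeneous map on the
    whole space, [H x = c^-1 F (c x)] for any small [c > 0]. *)
Lemma ball_homogeneous_nonexpansive_isometry (R : realType)
    (X Y : normedModType R) (F : X -> Y) :
  (forall a x, `|a| <= 1 -> unit_ball X x -> F (a *: x) = a *: F x) ->
  (forall x, unit_ball X x -> `|F x| = `|x|) ->
  nonexpansive_on (unit_ball X) F ->
  forall x y, unit_ball X x -> unit_ball X y -> `|F x - F y| = `|x - y|.
Proof.
move=> FZ Fnorm Fle.
pose H x := (1 + `|x|) *: F ((1 + `|x|)^-1 *: x).
have rescale c c' x : 0 < c -> c <= c' -> c' * `|x| <= 1 ->
    c^-1 *: F (c *: x) = c'^-1 *: F (c' *: x).
  move=> c0 cc' c'x; have c'0 := lt_le_trans c0 cc'.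
  have -> : c *: x = (c / c') *: (c' *: x).
    by rewrite scalerA divfK// gt_eqF.
  rewrite FZ ?scalerA.
  - by rewrite mulrA mulVf ?mul1r// gt_eqF.
  - by rewrite ger0_norm ?divr_ge0 ?(ltW c0) ?(ltW c'0)// ler_pdivrMr// mul1r.
  - by rewrite /unit_ball/= normrZ gtr0_norm.
have HE c x : 0 < c -> c * `|x| <= 1 -> H x = c^-1 *: F (c *: x).
  move=> c0 cx; have x1 : 0 < 1 + `|x| by rewrite ltr_wpDr.
  have bx : (1 + `|x|)^-1 * `|x| <= 1.
    by rewrite mulrC ler_pdivrMr// mul1r lerDr.
  rewrite /H -[X in X *: F _]invrK.
  have [bc|/ltW cb] := leP (1 + `|x|)^-1 c; first exact: rescale.
  by rewrite (@rescale c (1 + `|x|)^-1).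
have HF x : unit_ball X x -> H x = F x.
  by move=> Bx; rewrite (@HE 1) ?mul1r// invr1 !scale1r.
(* One factor bringing finitely many vectors into the ball lets the properties
   of [F] be transported to [H]. *)
have small (s : seq X) : exists2 c : R, 0 < c & {in s, forall x, c * `|x| <= 1}.
  elim: s => [|x s [c c0 IH]]; first by exists 1.
  exists (Num.min c (1 + `|x|)^-1).
    by rewrite lt_min c0 invr_gt0 ltr_wpDr.
  move=> y; rewrite inE => /orP[/eqP ->|/IH cy].
    rewrite (@le_trans _ _ ((1 + `|x|)^-1 * `|x|))//.
      by rewrite ler_wpM2r// ge_min lexx orbT.
    by rewrite mulrC ler_pdivrMr ?mul1r ?lerDr// ltr_wpDr.
  by apply: le_trans cy; rewrite ler_wpM2r// ge_min lexx.
have HZ a x : H (a *: x) = a *: H x.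
  have [c c0 cs] := small [:: x; a *: x].
  have cx : c * `|x| <= 1 by apply: cs; rewrite inE eqxx.
  have cax : c * `|a *: x| <= 1 by apply: cs; rewrite !inE eqxx orbT.
  have Bcx : unit_ball X (c *: x) by rewrite /unit_ball/= normrZ gtr0_norm.
  have Bcax : unit_ball X (c *: (a *: x)).
    by rewrite /unit_ball/= normrZ gtr0_norm.
  rewrite (HE c)// (HE c x)// [RHS]scalerA [a * _]mulrC -[RHS]scalerA.
  congr (_ *: _).
  have [a1|/ltW a1] := leP `|a| 1.
    by rewrite -FZ// !scalerA mulrC.
  have a0 : a != 0 by rewrite -normr_gt0 (lt_le_trans ltr01).
  have -> : F (c *: x) = a^-1 *: F (c *: (a *: x)).
    rewrite -FZ ?normfV ?invf_le1 ?normr_gt0//; congr F.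
    by rewrite !scalerA mulrAC mulVf// mul1r.
  by rewrite [RHS]scalerA mulfV// scale1r.
have Hnorm x : `|H x| = `|x|.
  have [c c0 cs] := small [:: x].
  have cx : c * `|x| <= 1 by apply: cs; rewrite inE eqxx.
  rewrite (HE c)// normrZ Fnorm.
    by rewrite -normrZ scalerK// gt_eqF.
  by rewrite /unit_ball/= normrZ gtr0_norm.
have Hle x y : `|H x - H y| <= `|x - y|.
  have [c c0 cs] := small [:: x; y].
  have cx : c * `|x| <= 1 by apply: cs; rewrite inE eqxx.
  have cy : c * `|y| <= 1 by apply: cs; rewrite !inE eqxx orbT.
  rewrite (HE c)// (HE c y)// -scalerBr normrZ gtr0_norm ?invr_gt0//.
  rewrite ler_pdivrMl//.
  have -> : c * `|x - y| = `|c *: x - c *: y|.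
    by rewrite -scalerBr normrZ gtr0_norm.
  by apply: Fle; rewrite /unit_ball/= normrZ gtr0_norm.
move=> x y Bx By; rewrite -!HF//.
exact: homogeneous_nonexpansive_isometry.
Qed.

(** * An intermediate value theorem *)

(** The Lipschitz bound is needed on the interval only: composing with the
    retraction of the line onto the interval gives a continuous function on
    the line. *)
Lemma lipschitz_IVT (R : realType) (f : R -> R) (a b k v : R) : a <= b ->
  {in `[a, b] &, forall s t, `|f s - f t| <= k * `|s - t|} ->
  f a <= v <= f b -> exists2 c, c \in `[a, b] & f c = v.
Proof.
move=> ab fk vab; pose g s := f (Num.max a (Num.min s b)).
have clampI s : Num.max a (Num.min s b) \in `[a, b].
  by rewrite in_itv/= le_max lexx/= ge_max ab ge_min lexx orbT.
have clampE s : s \in `[a, b] -> Num.max a (Num.min s b) = s.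
  by rewrite in_itv/= => /andP[as_ sb]; rewrite (min_idPl sb) (max_idPr as_).
have clampL s t :
    `|Num.max a (Num.min s b) - Num.max a (Num.min t b)| <= `|s - t|.
  have := ler_norm (s - t); have := ler_norm (t - s); rewrite [`|t - s|]distrC.
  set d := `|s - t|; rewrite ler_norml => ts st.
  by case: (leP s b); case: (leP t b); case: (leP a s); case: (leP a t);
    case: (leP a b); move=> *; apply/andP; split; lra.
have k0 : a < b -> 0 <= k.
  move=> ltab; have := fk a b; rewrite !in_itv/= !lexx ab => /(_ isT isT).
  move=> /(le_trans (normr_ge0 _)); rewrite pmulr_lge0// normr_gt0 subr_eq0.
  by rewrite lt_eqF.
have [eab|ltab] := eqVneq a b.
  exists a; first by rewrite in_itv/= lexx.
  by apply/eqP; rewrite eq_le; rewrite -eab in vab.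
have gc : continuous g.
  move=> s; apply/cvgrPdist_le => e e0.
  have k1 : 0 < k + 1 by rewrite ltr_wpDl// k0// lt_neqAle ltab.
  near=> t; rewrite /g; apply: le_trans (fk _ _ (clampI _) (clampI _)) _.
  have st : `|s - t| <= e / (k + 1).
    near: t; apply: cvgr_dist_le; first exact: cvg_id.
    by rewrite divr_gt0.
  apply: (@le_trans _ _ ((k + 1) * `|s - t|)).
    by rewrite ler_pM ?clampL ?k0 ?lerDl// lt_neqAle ltab.
  by rewrite mulrC -ler_pdivlMr.
have gab : g a <= v <= g b by rewrite /g !clampE// in_itv/= ?lexx ?ab.
have [|c cab gcv] := @IVT R g a b v ab (continuous_subspaceT gc).
  case/andP: gab => ga gb.
  by rewrite (min_idPl (le_trans ga gb)) (max_idPr (le_trans ga gb)) ga.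
by exists c => //; rewrite -gcv /g clampE.
Unshelve. all: by end_near. Qed.

(** * Rays through one summand *)

Section Homogeneity.
Context {R : realType} {X : normedModType R} {I : choiceType}.
Context {Z : I -> normedModType R}.
Hypothesis Zsc : forall i, strictly_convex (Z i).
Variables (F : X -> l1sum Z) (G : l1sum Z -> X).
Hypothesis Finj : forall x y, `|x| <= 1 -> `|y| <= 1 -> F x = F y -> x = y.
Hypothesis Fle : forall x y, `|x| <= 1 -> `|y| <= 1 -> `|F x - F y| <= `|x - y|.
Hypothesis Gball : forall z, `|z| <= 1 -> `|G z| <= 1.
Hypothesis GK : forall z, `|z| <= 1 -> F (G z) = z.
Implicit Types z : l1sum Z.

(** Every point of the ball of the sum is within [1] of [F 0]; if [F 0] were not
    [0], the unit vector opposite to it would be at distance [1 + |F 0|]. *)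
Lemma F0 : F 0 = 0.
Proof.
apply/eqP; rewrite -normr_le0; have [->|F00] := eqVneq (F 0) 0.
  by rewrite normr0.
have nF : 0 < `|F 0| by rewrite normr_gt0.
pose z := - (`|F 0|^-1 *: F 0).
have z1 : `|z| = 1 by rewrite normrN normrZ normfV normr_id mulVf ?gt_eqF.
have := @Fle 0 (G z); rewrite normr0 GK ?z1// => /(_ ler01 (Gball _)).
rewrite z1 => /(_ (lexx _)); rewrite sub0r normrN.
have -> : F 0 - z = (1 + `|F 0|^-1) *: F 0 by rewrite opprK scalerDl scale1r.
have := @Gball z; rewrite z1 lexx => /(_ isT).
rewrite normrZ ger0_norm ?addr_ge0// mulrDl mul1r mulVf ?gt_eqF//; lra.
Qed.

Lemma Fnorm x : `|x| <= 1 -> `|F x| <= `|x|.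
Proof.
by move=> x1; have := @Fle x 0; rewrite F0 !subr0 normr0; apply.
Qed.

(** The image of [a G e] is within [a] of [0] and within [1 - a] of [e], so it
    lies on the segment between them. *)
Lemma F_unit_nneg i e a : supported_at i e -> `|e| = 1 -> 0 <= a <= 1 ->
  F (a *: G e) = a *: e.
Proof.
move=> ei e1 /andP[a0 a1].
have Ge : `|G e| <= 1 by rewrite Gball ?e1.
have aGe : `|a *: G e| <= a by rewrite normrZ ger0_norm// ler_piMr.
have va : `|F (a *: G e)| <= a by rewrite (le_trans (Fnorm _))// (le_trans aGe).
have ev : `|e - F (a *: G e)| <= 1 - a.
  rewrite -{1}(GK (z := e)) ?e1//; apply: le_trans (Fle _ _) _ => //.
    exact: le_trans a1.
  rewrite -{1}[G e]scale1r -scalerBl normrZ ger0_norm ?subr_ge0//.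
  by rewrite ler_piMr ?subr_ge0.
have vE : F (a *: G e) = `|F (a *: G e)| *: e.
  have := @l1norm_segment _ _ _ Zsc i e (F (a *: G e)) ei.
  by rewrite e1 scale1r; apply; lra.
rewrite vE; congr (_ *: _); apply/eqP; rewrite eq_le va/=.
move: ev; rewrite vE; move: `|F _| va => b ba.
rewrite -{1}[e]scale1r -scalerBl normrZ e1 mulr1 normrZ e1 mulr1.
have := ler_norm (1 - b); have := ler_norm b; lra.
Qed.

(** The midpoint [m] of [G e] and [G (-e)] is within [1] of both, so [F m] is
    within [1] of [e] and [-e]; extremality of [e] leaves only [F m = 0]. *)
Lemma GN_unit i e : supported_at i e -> `|e| = 1 -> G (- e) = - G e.
Proof.
move=> ei e1.
have Ge : `|G e| <= 1 by rewrite Gball ?e1.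
have GNe : `|G (- e)| <= 1 by rewrite Gball ?normrN ?e1.
pose m := 2^-1 *: (G e + G (- e)).
have m1 : `|m| <= 1.
  rewrite normrZ ger0_norm ?invr_ge0// ler_pdivrMl//.
  by apply: le_trans (ler_normD _ _) _; rewrite mulr1; lra.
have half : `|2^-1 *: (G e - G (- e))| <= 1.
  rewrite normrZ ger0_norm ?invr_ge0// ler_pdivrMl//.
  by apply: le_trans (ler_normB _ _) _; rewrite mulr1; lra.
have hD (x : X) : x = 2^-1 *: x + 2^-1 *: x.
  by rewrite -scalerDl -[LHS]scale1r; congr (_ *: _); field.
have em : `|e - F m| <= 1.
  rewrite -{1}(GK (z := e)) ?e1//; apply: le_trans (Fle _ _) _ => //.
  rewrite (_ : G e - m = 2^-1 *: (G e - G (- e)))//.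
  by rewrite /m {1}[G e]hD scalerDr scalerBr opprD addrACA subrr add0r.
have em' : `|e + F m| <= 1.
  rewrite -normrN opprD -{1}(GK (z := - e)) ?normrN ?e1//.
  apply: le_trans (Fle _ _) _ => //.
  rewrite (_ : G (- e) - m = - (2^-1 *: (G e - G (- e)))) ?normrN//.
  rewrite /m {1}[G (- e)]hD scalerDr scalerBr opprB opprD.
  rewrite [- (_ *: G e) - _]addrC.
  by rewrite addrACA subrr add0r.
have n2 : `|2 *: e| = 2 by rewrite normrZ e1 mulr1 ger0_norm.
have := @l1norm_segment _ _ _ Zsc i (2 *: e) (e - F m) (supported_atZ 2 ei).
rewrite n2 (_ : 2 *: e - (e - F m) = e + F m); last first.
  by rewrite scaler_nat mulr2n opprB addrACA subrr addr0.
move=> H.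
have {H} : e - F m = `|e - F m| *: e.
  apply: (@scalerI _ _ 2); first by rewrite pnatr_eq0.
  by rewrite H ?scalerA 1?mulrC//; lra.
move: em; set c := `|_| => c1 emE.
have Fm : F m = (1 - c) *: e by rewrite scalerBl scale1r -emE opprB addrC subrK.
have {em'} : `|(1 + (1 - c)) *: e| <= 1 by rewrite scalerDl scale1r -Fm.
rewrite normrZ e1 mulr1 ger0_norm; last by lra.
move=> c2; have c_eq1 : c = 1 by lra.
have : m = 0 by apply: Finj => //; rewrite ?normr0// Fm c_eq1 subrr scale0r F0.
move=> /eqP; rewrite scaler_eq0 invr_eq0 pnatr_eq0/= addrC addr_eq0.
by move=> /eqP.
Qed.

Lemma F_unit i e a : supported_at i e -> `|e| = 1 -> `|a| <= 1 ->
  F (a *: G e) = a *: e.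
Proof.
move=> ei e1 a1; have [a0|/ltW a0] := leP 0 a.
  by apply: (F_unit_nneg ei) => //; rewrite a0 -(ger0_norm a0).
have -> : a *: G e = (- a) *: G (- e).
  by rewrite (GN_unit ei e1) scaleNr scalerN opprK.
have -> : a *: e = (- a) *: - e by rewrite scaleNr scalerN opprK.
apply: (@F_unit_nneg i) => [j ji||].
- by rewrite l1funN ei// oppr0.
- by rewrite normrN.
- by rewrite oppr_ge0 a0 -(ler0_norm a0).
Qed.

Lemma G0 : G 0 = 0.
Proof. by apply: Finj; rewrite ?normr0 ?GK ?F0 ?Gball ?normr0. Qed.

Lemma G_unitZ i e a : supported_at i e -> `|e| = 1 -> `|a| <= 1 ->
  G (a *: e) = a *: G e.
Proof.
move=> ei e1 a1.
have ae : `|a *: e| <= 1 by rewrite normrZ e1 mulr1.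
apply: Finj; rewrite ?Gball ?GK ?(F_unit ei e1)//.
by rewrite normrZ mulr_ile1 ?Gball ?e1.
Qed.

Lemma G_supported_at i u a : supported_at i u -> `|u| <= 1 -> `|a| <= 1 ->
  G (a *: u) = a *: G u.
Proof.
move=> ui u1 a1; have [->|u0] := eqVneq u 0.
  by rewrite scaler0 G0 scaler0.
have [e [ei e1 ->]] := supported_at_unit ui u0.
rewrite scalerA !(G_unitZ ei e1) ?scalerA ?normr_id//.
by rewrite normrM normr_id mulr_ile1.
Qed.

Lemma Gnorm_supported_at i u : supported_at i u -> `|u| <= 1 -> `|G u| <= `|u|.
Proof.
move=> ui u1; have [->|u0] := eqVneq u 0; first by rewrite G0 !normr0.
have [e [ei e1 uE]] := supported_at_unit ui u0.
rewrite {1}uE (G_unitZ ei e1) ?normr_id// normrZ normr_id ler_piMr//.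
by rewrite Gball ?e1.
Qed.

(** * Two summands *)

Section Pair.
Variables (i j : I) (e f : l1sum Z).
Hypotheses (ij : i != j) (ei : supported_at i e) (fj : supported_at j f).
Hypotheses (e1 : `|e| = 1) (f1 : `|f| = 1).

Let ej0 : e j = 0. Proof. by apply: ei; rewrite eq_sym. Qed.
Let fi0 : f i = 0. Proof. exact: fj. Qed.
Let nei : `|e i| = 1. Proof. by rewrite -(l1norm_single ei). Qed.
Let nfj : `|f j| = 1. Proof. by rewrite -(l1norm_single fj). Qed.

Let combi a b : (a *: e + b *: f) i = a *: e i.
Proof. by rewrite l1funD !l1funZ fi0 scaler0 addr0. Qed.
Let combj a b : (a *: e + b *: f) j = b *: f j.
Proof. by rewrite l1funD !l1funZ ej0 scaler0 add0r. Qed.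
Let combk a b k : k != i -> k != j -> (a *: e + b *: f) k = 0.
Proof. by move=> ki kj; rewrite l1funD !l1funZ ei// fj// !scaler0 addr0. Qed.
Let combr a b :
  restriction [pred k | (k != i) && (k != j)] (a *: e + b *: f) = 0.
Proof.
apply: l1sumP => k; rewrite restrictionE /=.
by case: ifP => // /andP[ki kj]; exact: combk.
Qed.

Lemma l1norm_pair a b : `|a *: e + b *: f| = `|a| + `|b|.
Proof.
rewrite (l1norm_coord2 _ ij) combr normr0 addr0 combi combj.
by rewrite !normrZ nei nfj !mulr1.
Qed.

(** The last term, the part of [v] outside the two summands, is what the
    estimates below force to vanish. *)
Lemma l1norm_pair_dist (v : l1sum Z) a b : `|v - (a *: e + b *: f)| =
  `|v i - a *: e i| + `|v j - b *: f j| +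
  `|restriction [pred k | (k != i) && (k != j)] v|.
Proof.
rewrite (l1norm_coord2 _ ij) restrictionB combr subr0.
by rewrite !l1funD !l1funN combi combj.
Qed.

Lemma pair_decomposition (v : l1sum Z) :
  v i = `|v i| *: e i -> v j = `|v j| *: f j ->
  restriction [pred k | (k != i) && (k != j)] v = 0 ->
  v = `|v i| *: e + `|v j| *: f.
Proof.
move=> vi vj vr; apply: l1sumP => k.
have [->|ki] := eqVneq k i; first by rewrite combi.
have [->|kj] := eqVneq k j; first by rewrite combj.
rewrite combk//; have := congr1 (fun z : l1sum Z => z k) vr.
by rewrite restrictionE /= ki kj.
Qed.

Lemma pair_ball a b : 0 <= a -> 0 <= b -> `|a *: G e + b *: G f| <= a + b.
Proof.
move=> a0 b0; apply: le_trans (ler_normD _ _) _.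
by rewrite lerD// normrZ ger0_norm// ler_piMr// Gball ?e1 ?f1.
Qed.

(** The image [v] is within [a] of [b f] and within [b] of [a e].  Adding the
    two bounds, written out in components, gives equality everywhere: the
    components of [v] at [i] and [j] lie on the segments from [0] to [a e] and
    from [0] to [b f], all others are zero, and the two defects agree. *)
Lemma pair_shrink a b : 0 <= a -> 0 <= b -> a + b <= 1 ->
  exists c, [/\ 0 <= c, c <= a, c <= b &
    F (a *: G e + b *: G f) = (a - c) *: e + (b - c) *: f].
Proof.
move=> a0 b0 ab1.
have ball := le_trans (pair_ball a0 b0) ab1.
have a1 : `|a| <= 1 by rewrite ger0_norm//; lra.
have b1 : `|b| <= 1 by rewrite ger0_norm//; lra.
have unitZ (c : R) z : `|c| <= 1 -> `|z| = 1 -> `|c *: G z| <= `|c|.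
  by move=> c1 z1; rewrite normrZ ler_piMr// Gball ?z1.
have ae := unitZ _ _ a1 e1; have bf := unitZ _ _ b1 f1.
set v := F _.
have : `|v - (0 *: e + b *: f)| <= a.
  rewrite scale0r add0r -(F_unit fj f1)//; apply: le_trans (Fle _ _) _ => //.
    exact: le_trans b1.
  by rewrite addrK (le_trans ae)// ger0_norm.
have : `|v - (a *: e + 0 *: f)| <= b.
  rewrite scale0r addr0 -(F_unit ei e1)//; apply: le_trans (Fle _ _) _ => //.
    exact: le_trans a1.
  by rewrite addrC addKr (le_trans bf)// ger0_norm.
rewrite !l1norm_pair_dist !scale0r !subr0.
set r := `|restriction _ _| => vb va.
have r0 : 0 <= r by exact: normr_ge0.
have ai : a <= `|v i| + `|v i - a *: e i|.
  exact: unit_triangle.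
have bj : b <= `|v j| + `|v j - b *: f j|.
  exact: unit_triangle.
have vi : v i = `|v i| *: e i.
  by apply: (strictly_convex_ray _ nei a0) => //; lra.
have vj : v j = `|v j| *: f j.
  by apply: (strictly_convex_ray _ nfj b0) => //; lra.
have vr : restriction [pred k | (k != i) && (k != j)] v = 0.
  by apply: normr0_eq0; rewrite -/r; lra.
have := normr_ge0 (v i); have := normr_ge0 (v j).
have := normr_ge0 (v i - a *: e i); have := normr_ge0 (v j - b *: f j).
exists (a - `|v i|); split; [lra|lra|lra|].
rewrite {1}(pair_decomposition vi vj vr); congr (_ *: _ + _ *: _); lra.
Qed.

(** The distances to [0] and to the unit vector [p e + q f] add up to at most
    [1], which forces equality in the triangle inequality for each component. *)
Lemma pair_between p q t (v : l1sum Z) : 0 <= p -> 0 <= q -> p + q = 1 ->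
  `|v| <= t -> `|v - (p *: e + q *: f)| <= 1 - t ->
  v = `|v i| *: e + `|v j| *: f.
Proof.
move=> p0 q0 pq vt; rewrite l1norm_pair_dist.
move: vt; rewrite (l1norm_coord2 _ ij); set r := `|restriction _ _| => vt vpq.
have r0 : 0 <= r by exact: normr_ge0.
have ai : p <= `|v i| + `|v i - p *: e i|.
  exact: unit_triangle.
have bj : q <= `|v j| + `|v j - q *: f j|.
  exact: unit_triangle.
apply: pair_decomposition.
- by apply: (strictly_convex_ray _ nei p0) => //; lra.
- by apply: (strictly_convex_ray _ nfj q0) => //; lra.
- by apply: normr0_eq0; rewrite -/r; lra.
Qed.

(** Injectivity excludes [d = 0], which would give [G e = - G f]. *)
Lemma pair_corner : exists2 d, 0 < d <= 2^-1 &
  F (2^-1 *: G e + 2^-1 *: G f) = d *: e + d *: f.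
Proof.
have h0 : 0 <= 2^-1 :> R by rewrite invr_ge0.
have [|c [c0 c2 _ FE]] := pair_shrink h0 h0; first by lra.
exists (2^-1 - c) => //; apply/andP; split; last by lra.
rewrite lt_neqAle subr_ge0 c2 andbT eq_sym; apply/eqP => d0.
have ball : `|2^-1 *: G e + 2^-1 *: G f| <= 1.
  by apply: le_trans (pair_ball _ _) _ => //; lra.
have : G e = -1 *: G f.
  rewrite scaleN1r; apply/eqP; rewrite -addr_eq0.
  have /eqP : 2^-1 *: G e + 2^-1 *: G f = 0.
    by apply: Finj => //; rewrite ?normr0// FE d0 !scale0r addr0 F0.
  by rewrite -scalerDr scaler_eq0 invr_eq0 pnatr_eq0.
move=> /(congr1 F); rewrite GK ?e1// (F_unit fj f1) ?normrN1// scaleN1r.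
move=> /(congr1 (fun z : l1sum Z => `|z i|)).
by rewrite l1funN fi0 oppr0 normr0 nei => /eqP; rewrite oner_eq0.
Qed.

(** By [pair_shrink] the map [F] carries the diagonal
    [s |-> (t + s) G e + s G f] into [s |-> (t + s) e + s f], and on the latter
    the norm determines the point.  The end [s = 1/2 - t] is at distance at
    most [t] from [(G e + G f) / 2], whose image has norm [2 d]; so the norms
    along the image of the diagonal reach [2 d - t], which for [t = c1 - c2] is
    at least [c1 + c2]. *)
Lemma pair_fill_le d c1 c2 : 0 < d <= 2^-1 ->
  F (2^-1 *: G e + 2^-1 *: G f) = d *: e + d *: f ->
  0 <= c2 -> c2 <= c1 -> c1 <= d ->
  exists a b, [/\ 0 <= a, 0 <= b, a + b <= 1 &
    F (a *: G e + b *: G f) = c1 *: e + c2 *: f].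
Proof.
move=> /andP[d0 d2] Fd c20 c21 c1d; pose t := c1 - c2.
have t0 : 0 <= t by rewrite subr_ge0.
have td : t <= d by rewrite /t; lra.
pose P s := (t + s) *: G e + s *: G f.
have ts s : s \in `[0, 2^-1 - t] -> [/\ 0 <= s, 0 <= t + s & t + s + s <= 1].
  by rewrite in_itv/= => /andP[? ?]; split; lra.
have PB s : s \in `[0, 2^-1 - t] -> `|P s| <= 1.
  by move=> /ts[s0 ts0 ts1]; apply: le_trans (pair_ball ts0 s0) ts1.
have [|||s sI Ps] :=
  @lipschitz_IVT R (fun s => `|F (P s)|) 0 (2^-1 - t) 2 (c1 + c2).
- by lra.
- move=> s r sI rI; apply: le_trans (ler_dist_dist _ _) _.
  apply: le_trans (Fle (PB _ sI) (PB _ rI)) _.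
  rewrite /P opprD addrACA -!scalerBl opprD addrACA subrr add0r.
  apply: le_trans (ler_normD _ _) _; rewrite !normrZ.
  by rewrite mulr2n mulrDl mul1r lerD// ler_piMr// Gball ?e1 ?f1.
- apply/andP; split.
    rewrite /P addr0 scale0r addr0.
    rewrite (F_unit ei e1); last by rewrite ger0_norm//; lra.
    by rewrite normrZ e1 mulr1 ger0_norm//; rewrite /t; lra.
  have eI : 2^-1 - t \in `[0, 2^-1 - t] by rewrite in_itv/= lexx andbT; lra.
  have h1 : `|2^-1 *: G e + 2^-1 *: G f| <= 1.
    by apply: le_trans (pair_ball _ _) _ => //; lra.
  have := Fle h1 (PB _ eI).
  have -> : 2^-1 *: G e + 2^-1 *: G f - P (2^-1 - t) = t *: G f.
    rewrite /P [t + _]addrC subrK opprD addrACA subrr add0r -scalerBl.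
    by congr (_ *: _); lra.
  rewrite normrZ ger0_norm// => Ft.
  have {Ft} Ft := le_trans Ft (ler_piMr t0 (Gball _)).
  have {Ft} Ft : `|F (2^-1 *: G e + 2^-1 *: G f) - F (P (2^-1 - t))| <= t.
    by apply: Ft; rewrite f1.
  have := ler_normD (F (2^-1 *: G e + 2^-1 *: G f) - F (P (2^-1 - t)))
    (F (P (2^-1 - t))).
  rewrite subrK {1}Fd l1norm_pair !ger0_norm ?(ltW d0)//.
  by rewrite /t in Ft *; lra.
have [s0 ts0 ts1] := ts _ sI.
exists (t + s), s; split => //.
have [c [c0 cts cs FE]] := pair_shrink ts0 s0 ts1.
move: Ps; rewrite /P FE l1norm_pair !ger0_norm ?subr_ge0// => Ps.
by congr (_ *: _ + _ *: _); rewrite /t in Ps *; lra.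
Qed.

End Pair.

Lemma pair_fill i j e f : i != j -> supported_at i e -> supported_at j f ->
  `|e| = 1 -> `|f| = 1 ->
  exists2 d, 0 < d <= 2^-1 & forall c1 c2, 0 <= c1 <= d -> 0 <= c2 <= d ->
    exists a b, [/\ 0 <= a, 0 <= b, a + b <= 1 &
      F (a *: G e + b *: G f) = c1 *: e + c2 *: f].
Proof.
move=> ij ei fj e1 f1; have [d d0 Fd] := pair_corner ij ei fj e1 f1.
exists d => // c1 c2 /andP[c10 c1d] /andP[c20 c2d].
have [c21|/ltW c12] := leP c2 c1.
  exact: (pair_fill_le ij ei fj e1 f1 d0 Fd).
rewrite addrC [in RHS]addrC in Fd.
have ji : j != i by rewrite eq_sym.
have [b [a [b0 a0 ba FE]]] := pair_fill_le ji fj ei f1 e1 d0 Fd c10 c12 c2d.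
by exists a, b; split; rewrite // addrC // [RHS]addrC.
Qed.

(** For [z = p e + q f] of norm one, the image of [d G z] is between [0] and
    [z], hence in the quadrant, and small enough to be covered by [pair_fill].
    Injectivity then places [G z] in the cone of [G e] and [G f], with
    coefficients of sum at most [1].  Since [F] lowers both coefficients by the
    same [c >= 0] and the result [z] has coefficients of sum [1], [c] is
    zero. *)
Lemma pair_sphere i j e f p q : i != j -> supported_at i e ->
  supported_at j f -> `|e| = 1 -> `|f| = 1 -> 0 <= p -> 0 <= q -> p + q = 1 ->
  F (p *: G e + q *: G f) = p *: e + q *: f.
Proof.
move=> ij ei fj e1 f1 p0 q0 pq.
have [d /andP[d0 d2] fill] := pair_fill ij ei fj e1 f1.
set z := p *: e + q *: f; set x := G z.
have z1 : `|z| <= 1 by rewrite (l1norm_pair ij)// !ger0_norm ?pq.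
have x1 : `|x| <= 1 by exact: Gball.
have dxd : `|d *: x| <= d by rewrite normrZ gtr0_norm// ler_piMr// ltW.
have dx1 : `|d *: x| <= 1 by apply: le_trans dxd _; lra.
have vd : `|F (d *: x)| <= d by exact: le_trans (Fnorm dx1) dxd.
have vE : F (d *: x) = `|F (d *: x) i| *: e + `|F (d *: x) j| *: f.
  apply: (pair_between ij ei fj e1 f1 p0 q0 pq vd).
  rewrite -/z -[z in leLHS](GK z1) distrC; apply: le_trans (Fle x1 dx1) _.
  rewrite -/x -{1}[x]scale1r -scalerBl normrZ ger0_norm; last by lra.
  by rewrite ler_piMr//; lra.
have vd2 : `|F (d *: x) i| + `|F (d *: x) j| <= d.
  by move: vd; rewrite {1}vE (l1norm_pair ij)// !normr_id.
have [||a [b [a0 b0 ab1 FE]]] := fill `|F (d *: x) i| `|F (d *: x) j|.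
- by rewrite normr_ge0/=; have := normr_ge0 (F (d *: x) j); lra.
- by rewrite normr_ge0/=; have := normr_ge0 (F (d *: x) i); lra.
have ball := le_trans (pair_ball e1 f1 a0 b0) ab1.
have dxE : d *: x = a *: G e + b *: G f.
  by apply: Finj => //; rewrite FE.
have abd : a + b <= d.
  apply: le_trans dxd; rewrite dxE.
  have -> : a + b = `|a *: e - (- b) *: f|.
    by rewrite -scaleNr opprK (l1norm_pair ij)// !ger0_norm.
  rewrite -(F_unit ei e1); last by rewrite ger0_norm//; lra.
  rewrite -(F_unit fj f1); last by rewrite normrN ger0_norm//; lra.
  rewrite -[b in leRHS]opprK [- - b *: _]scaleNr; apply: Fle.
    by rewrite normrZ ger0_norm// mulr_ile1 ?Gball ?e1//; lra.
  by rewrite normrZ normrN ger0_norm// mulr_ile1 ?Gball ?f1//; lra.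
have xE : x = (a / d) *: G e + (b / d) *: G f.
  rewrite -[LHS](scalerK (a := d)) ?gt_eqF// dxE scalerDr !scalerA.
  by rewrite ![d^-1 * _]mulrC.
have ad0 : 0 <= a / d by rewrite divr_ge0// ltW.
have bd0 : 0 <= b / d by rewrite divr_ge0// ltW.
have abd1 : a / d + b / d <= 1 by rewrite -mulrDl ler_pdivrMr// mul1r.
have [c [c0 ca cb]] := pair_shrink ij ei fj e1 f1 ad0 bd0 abd1.
rewrite -xE /x GK// => zE.
have coord k : z k = (a / d - c) *: e k + (b / d - c) *: f k by rewrite zE.
have pE : p = a / d - c.
  have := congr1 Num.norm (coord i).
  rewrite /z l1funD !l1funZ (fj _ ij) !scaler0 !addr0 !normrZ.
  rewrite -(l1norm_single ei).
  by rewrite e1 !mulr1 !ger0_norm// subr_ge0.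
have qE : q = b / d - c.
  have := congr1 Num.norm (coord j).
  rewrite /z l1funD !l1funZ (ei j) 1?eq_sym// !scaler0 !add0r !normrZ.
  rewrite -(l1norm_single fj).
  by rewrite f1 !mulr1 !ger0_norm// subr_ge0.
have c_eq0 : c = 0 by lra.
by rewrite pE qE c_eq0 !subr0 -xE GK// zE c_eq0 !subr0.
Qed.

(** The diagonal through [a G e + b G f] meets the sphere at a point covered by
    [pair_sphere], at distance at most [2 s]; lowering the coefficients of the
    image of [a G e + b G f] by [c] puts the two images [2 s + 2 c] apart. *)
Lemma pair_identity i j e f a b : i != j -> supported_at i e ->
  supported_at j f -> `|e| = 1 -> `|f| = 1 -> 0 <= a -> 0 <= b -> a + b <= 1 ->
  F (a *: G e + b *: G f) = a *: e + b *: f.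
Proof.
move=> ij ei fj e1 f1 a0 b0 ab1; pose s := (1 - a - b) / 2.
have s0 : 0 <= s by rewrite /s; lra.
have as0 : 0 <= a + s by rewrite addr_ge0.
have bs0 : 0 <= b + s by rewrite addr_ge0.
have abs : (a + s) + (b + s) = 1 by rewrite /s; lra.
have [c [c0 ca cb FE]] := pair_shrink ij ei fj e1 f1 a0 b0 ab1.
have FS := pair_sphere ij ei fj e1 f1 as0 bs0 abs.
have B1 := le_trans (pair_ball e1 f1 a0 b0) ab1.
have B2 : `|(a + s) *: G e + (b + s) *: G f| <= 1.
  by apply: le_trans (pair_ball e1 f1 as0 bs0) _; rewrite abs.
have comb (V : lmodType R) (x y : V) (p q p' q' : R) :
    p *: x + q *: y - (p' *: x + q' *: y) = (p - p') *: x + (q - q') *: y.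
  by rewrite opprD addrACA -!scalerBl.
have := Fle B2 B1; rewrite FE FS !comb.
rewrite (l1norm_pair ij)// => /le_trans/(_ (ler_normD _ _)).
rewrite !normrZ.
have -> : a + s - (a - c) = s + c by ring.
have -> : b + s - (b - c) = s + c by ring.
have -> : a + s - a = s by ring.
have -> : b + s - b = s by ring.
rewrite !ger0_norm ?addr_ge0// => H.
have Ge : s * `|G e| <= s by rewrite ler_piMr// Gball ?e1.
have Gf : s * `|G f| <= s by rewrite ler_piMr// Gball ?f1.
have -> : c = 0 by lra.
by rewrite !subr0.
Qed.

(** * Finitely many summands *)

Lemma Gpart_le i z : `|z| <= 1 -> `|G (part i z)| <= `|z i|.
Proof.
move=> z1; rewrite -(l1norm_part i z).
apply: Gnorm_supported_at (part_le1 i z1).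
exact: part_supported_at.
Qed.

(** The value that [G z] takes once [z] is supported in [J]. *)
Definition Gsum (J : seq I) z := \sum_(i <- J) G (part i z).

Lemma Gsum_le J z : uniq J -> `|z| <= 1 -> `|Gsum J z| <= `|z|.
Proof.
move=> uJ z1; apply: le_trans (l1norm_ge_sum z uJ).
apply: le_trans (ler_norm_sum _ _ _) _; apply: ler_sum => i _.
exact: Gpart_le.
Qed.

Lemma GsumZ a J z : `|z| <= 1 -> `|a| <= 1 -> Gsum J (a *: z) = a *: Gsum J z.
Proof.
move=> z1 a1; rewrite /Gsum scaler_sumr; apply: eq_bigr => i _.
rewrite partZ (@G_supported_at i)//; [exact: part_supported_at|exact: part_le1].
Qed.

Lemma F_Gsum2 i j z : i != j -> (forall k, k \notin [:: i; j] -> z k = 0) ->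
  `|z| <= 1 -> F (G (part i z) + G (part j z)) = z.
Proof.
move=> ij zij z1.
have zE : part i z + part j z = z.
  apply: l1sumP => k; rewrite l1funD !restrictionE /=.
  have [->|ki] := eqVneq k i; first by rewrite (negPf ij) addr0.
  have [->|kj] := eqVneq k j; first by rewrite add0r.
  by rewrite addr0 zij// !inE negb_or ki.
have [i0|ui] := eqVneq (part i z) 0.
  by move: zE; rewrite i0 G0 !add0r => ->; rewrite GK.
have [j0|uj] := eqVneq (part j z) 0.
  by move: zE; rewrite j0 G0 !addr0 => ->; rewrite GK.
have [e [ei e1 iE]] := supported_at_unit (@part_supported_at _ _ _ i z) ui.
have [f [fj f1 jE]] := supported_at_unit (@part_supported_at _ _ _ j z) uj.
have ab : `|part i z| + `|part j z| <= 1.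
  rewrite !l1norm_part; apply: le_trans z1.
  have := @l1norm_ge_sum _ _ _ [:: i; j] z.
  by rewrite big_cons big_seq1 /= inE ij; apply.
rewrite -[RHS]zE; move: ab iE jE; move: `|part i z| (normr_ge0 (part i z)).
move: `|part j z| (normr_ge0 (part j z)) => b b0 a a0 ab -> ->.
rewrite (G_unitZ ei e1); last by rewrite ger0_norm//; lra.
rewrite (G_unitZ fj f1); last by rewrite ger0_norm//; lra.
exact: (pair_identity ij ei fj).
Qed.

(** Removing one component and applying the induction hypothesis gives
    [|v - z| <= 2 |v_k - z_k|] for each [k].  Three indices conclude; with two
    the inequality also holds for the candidates [v] left by [pair_shrink],
    which is why that case rests on [pair_identity]. *)
Lemma F_Gsum J z : uniq J -> (forall i, i \notin J -> z i = 0) -> `|z| <= 1 ->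
  F (Gsum J z) = z.
Proof.
have [n] := ubnP (size J); elim: n J z => // n IH J z.
rewrite ltnS => Jn uJ zJ z1.
have [J2|J3] := leqP (size J) 2.
  case: J J2 uJ zJ {Jn} => [|i [|j []]] // _.
  - move=> _ z0; rewrite /Gsum big_nil F0; apply: l1sumP => i.
    by rewrite z0// in_nil.
  - move=> _ zi; rewrite /Gsum big_seq1 (_ : part i z = z) ?GK//.
    apply: l1sumP => k; rewrite restrictionE /=.
    by case: eqP => // /eqP ki; rewrite zi// inE.
  - rewrite /= inE andbT => ij zij.
    by rewrite /Gsum big_cons big_seq1 F_Gsum2.
have wB : `|Gsum J z| <= 1 by apply: le_trans (Gsum_le uJ z1) z1.
set v := F _; suff : `|v - z| <= 0 by rewrite normr_le0 subr_eq0 => /eqP.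
have close k : k \in J -> `|v - z| <= 2 * `|(v - z) k|.
  move=> kJ; set z' := restriction (predC1 k) z.
  have z'1 : `|z'| <= 1.
    by apply: le_trans z1; rewrite (l1norm_coord k z) lerDr.
  have FE : F (Gsum (rem k J) z') = z'.
    apply: IH; rewrite ?rem_uniq//.
      by rewrite size_rem// prednK// (leq_ltn_trans _ J3).
    move=> i; rewrite mem_rem_uniq// inE negb_and negbK restrictionE /=.
    by case: eqP => //= _; exact: zJ.
  have GE : Gsum J z - Gsum (rem k J) z' = G (part k z).
    rewrite /Gsum (big_rem k)//= -addrA -[RHS]addr0; congr (_ + _).
    apply/eqP; rewrite subr_eq0; apply/eqP; apply: eq_big_seq => i.
    rewrite mem_rem_uniq// inE => /andP[ik _]; congr G; apply: l1sumP => j.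
    rewrite !restrictionE /=; case: eqP => // ->.
    by rewrite ik.
  have /Fle : `|Gsum J z| <= 1 by [].
  move=> /(_ (Gsum (rem k J) z')).
  rewrite FE GE => /(_ (le_trans (Gsum_le (rem_uniq _ uJ) z'1) z'1)).
  move=> /le_trans/(_ (Gpart_le k z1)).
  rewrite -/v (l1norm_coord k) (l1norm_coord k (v - z)) !restrictionB.
  have -> : restriction (predC1 k) z' = restriction (predC1 k) z.
    by apply: l1sumP => i; rewrite !restrictionE /=; case: eqP.
  rewrite !l1funD !l1funN [z' k]restrictionE /= eqxx subr0.
  have := ler_normD (v k) (- (v k - z k)).
  by rewrite normrN opprB addrC subrK; lra.
have [i [j [k [sJ uijk]]]] : exists i j k,
    {subset [:: i; j; k] <= J} /\ uniq [:: i; j; k].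
  case: (J) J3 uJ => [|i [|j [|k K]]] // _ uJ; exists i, j, k; split.
    by move=> l; rewrite !inE => /or3P[] ->; rewrite ?orbT.
  by move: uJ; rewrite -[i :: _]/([:: i; j; k] ++ K) cat_uniq => /andP[].
have := l1norm_ge_sum (v - z) uijk; rewrite !big_cons big_nil.
have ci : i \in J by apply: sJ; rewrite !inE eqxx.
have cj : j \in J by apply: sJ; rewrite !inE eqxx orbT.
have ck : k \in J by apply: sJ; rewrite !inE eqxx !orbT.
have := close _ ci; have := close _ cj; have := close _ ck; lra.
Qed.

(** * Passage to the limit *)

Hypothesis Xcomplete : forall u : nat -> X, cauchy (u @ \oo) -> cvg (u @ \oo).

Lemma Gsum_restriction J z : Gsum J (restriction (mem J) z) = Gsum J z.
Proof.
apply: eq_big_seq => i iJ; congr G; apply: l1sumP => j.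
by rewrite !restrictionE /=; case: eqP => // ->; rewrite iJ.
Qed.

Lemma F_scaled_Gsum a J z : uniq J -> `|z| <= 1 -> `|a| <= 1 ->
  F (a *: Gsum J z) = a *: restriction (mem J) z.
Proof.
move=> uJ z1 a1; have r1 := le_trans (l1norm_restriction_le (mem J) z) z1.
rewrite -Gsum_restriction -GsumZ// F_Gsum//.
  by move=> i iJ; rewrite l1funZ restrictionE /= (negPf iJ) scaler0.
by rewrite normrZ mulr_ile1.
Qed.

(** Only the indices in [L] outside [J] contribute, each at most [|z i|]. *)
Lemma Gsum_subset_dist J L z : uniq J -> uniq L -> {subset J <= L} ->
  `|z| <= 1 -> `|Gsum L z - Gsum J z| <= `|z - restriction (mem J) z|.
Proof.
move=> uJ uL JL z1; rewrite /Gsum (bigID (mem J)) /=.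
have -> : \sum_(i <- L | i \in J) G (part i z) = \sum_(i <- J) G (part i z).
  rewrite -big_filter; apply: perm_big; apply: uniq_perm => //.
    exact: filter_uniq.
  by move=> i; rewrite mem_filter andb_idr//; exact: JL.
rewrite addrAC subrr add0r.
apply: le_trans (l1norm_ge_sum _ uL); apply: le_trans (ler_norm_sum _ _ _) _.
rewrite big_mkcond; apply: ler_sum => i _.
rewrite l1funD l1funN restrictionE /=.
by case: (i \in J); rewrite /= ?subrr ?normr0// subr0; exact: Gpart_le.
Qed.

Lemma Gsum_dist J K z : uniq J -> uniq K -> `|z| <= 1 ->
  `|Gsum J z - Gsum K z| <=
  `|z - restriction (mem J) z| + `|z - restriction (mem K) z|.
Proof.
move=> uJ uK z1; pose L := undup (J ++ K).
have uL : uniq L by exact: undup_uniq.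
have JL : {subset J <= L} by move=> i iJ; rewrite mem_undup mem_cat iJ.
have KL : {subset K <= L} by move=> i iK; rewrite mem_undup mem_cat iK orbT.
rewrite (_ : Gsum J z - Gsum K z =
    - (Gsum L z - Gsum J z) + (Gsum L z - Gsum K z)); last first.
  by rewrite opprB addrA subrK.
apply: le_trans (ler_normD _ _) _.
by rewrite normrN lerD// Gsum_subset_dist.
Qed.

Lemma Gsum_limit z : `|z| <= 1 -> exists x : X, forall r, 0 < r ->
  exists J, [/\ uniq J, `|z - restriction (mem J) z| < r & `|x - Gsum J z| < r].
Proof.
move=> z1.
have /choice[J JP] : forall n : nat, exists J : seq I,
    uniq J /\ `|z - restriction (mem J) z| < n.+1%:R^-1.
  move=> n; have [|J uJ zJ] := @finite_restriction_dense _ _ _ z n.+1%:R^-1.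
    by rewrite invr_gt0.
  by exists J.
have uJ n := (JP n).1; have zJ n := (JP n).2.
pose u n := Gsum (J n) z.
have inv_le n m : (n <= m)%N -> m.+1%:R^-1 <= n.+1%:R^-1 :> R.
  by move=> nm; rewrite lef_pV2 ?posrE// ler_nat.
have inv_small (r : R) : 0 < r -> exists n, n.+1%:R^-1 < r.
  move=> r0; exists (Num.truncn r^-1).
  by rewrite invf_plt ?posrE// truncnS_gt.
have cu : cvg (u @ \oo).
  apply: Xcomplete; apply: cauchy_exP => r r0.
  have [N Nr] := inv_small (r / 2) (divr_gt0 r0 (ltr0Sn R 1)).
  exists (u N), N => // n /= Nn; rewrite -ball_normE /ball_ /=.
  apply: le_lt_trans (Gsum_dist (uJ N) (uJ n) z1) _.
  rewrite [r]splitr ltrD ?(lt_trans (zJ N))//.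
  exact: lt_le_trans (zJ n) (le_trans (inv_le _ _ Nn) (ltW Nr)).
exists (lim (u @ \oo)) => r r0.
have [N Nr] := inv_small r r0.
have /cvgrPdist_lt/(_ r r0)[M _ Mu] : u @ \oo --> lim (u @ \oo) by [].
exists (J (maxn M N)); split=> //; last by apply: Mu; rewrite /= leq_maxl.
apply: lt_le_trans (zJ _) _; apply: le_trans (ltW Nr).
by rewrite inv_le ?leq_maxr.
Qed.

(** The limit [x] of the finite sums satisfies [F (b x) = b z] for all
    [|b| <= 1] by continuity, and [b = 1] identifies it with [G z]. *)
Lemma G_homogeneous z a : `|z| <= 1 -> `|a| <= 1 ->
  `|G z| <= `|z| /\ F (a *: G z) = a *: z.
Proof.
move=> z1 a1; have [x xP] := Gsum_limit z1.
have xz : `|x| <= `|z|.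
  apply/ler_addgt0Pr => r r0; have [J [uJ _ /ltW xJ]] := xP _ r0.
  rewrite -[x](subrK (Gsum J z)) addrC; apply: le_trans (ler_normD _ _) _.
  by rewrite lerD// Gsum_le.
have x1 := le_trans xz z1.
have Fx b : `|b| <= 1 -> F (b *: x) = b *: z.
  move=> b1; apply/eqP; rewrite -subr_eq0 -normr_le0.
  apply/ler_addgt0Pr => r r0; rewrite add0r.
  have [|J [uJ /ltW zJ /ltW xJ]] := xP (r / 2); first by rewrite divr_gt0.
  have J1 : `|Gsum J z| <= 1 by apply: le_trans (Gsum_le uJ z1) z1.
  rewrite -[_ - _](subrKA (F (b *: Gsum J z))).
  apply: le_trans (ler_normD _ _) _; rewrite [r]splitr lerD//.
    apply: le_trans (Fle _ _) _; rewrite ?normrZ ?mulr_ile1//.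
    rewrite -scalerBr normrZ; apply: le_trans xJ.
    by rewrite ler_piMl.
  rewrite F_scaled_Gsum// -scalerBr normrZ distrC; apply: le_trans zJ.
  by rewrite ler_piMl.
have -> : G z = x.
  apply: Finj; rewrite ?Gball// GK//.
  by have := Fx 1; rewrite normr1 !scale1r => /(_ (lexx _)).
by split=> //; exact: Fx.
Qed.

End Homogeneity.

(** * Non-expansive bijections onto the ball of an l1-sum *)

Theorem theorem3p1 (R : realType) (X : completeNormedModType R)
    (I : choiceType) (Z : I -> completeNormedModType R)
    (Z_strictly_convex : forall i : I, strictly_convex (Z i))
    (F : X -> l1sum Z)
    (F_bij : set_bij (unit_ball X) (unit_ball (l1sum Z)) F)
    (F_nonexpansive : nonexpansive_on (unit_ball X) F) :
  forall x y : X, unit_ball X x -> unit_ball X y -> `|F x - F y| = `|x - y|.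
Proof.
have [Fball Finj Fsurj] := F_bij.
have /choice[G GP] : forall z, exists x : X,
    unit_ball (l1sum Z) z -> unit_ball X x /\ F x = z.
  move=> z; have [/Fsurj[x Bx Fx]|nBz] := pselect (unit_ball (l1sum Z) z).
    by exists x.
  by exists 0.
have Finj' x y : `|x| <= 1 -> `|y| <= 1 -> F x = F y -> x = y.
  by move=> Bx By; apply: Finj; rewrite inE.
have Gball z : `|z| <= 1 -> `|G z| <= 1 by move=> /GP[].
have GK z : `|z| <= 1 -> F (G z) = z by move=> /GP[].
have FK x : unit_ball X x -> x = G (F x).
  by move=> Bx; have FB := Fball _ Bx; apply: Finj'; rewrite ?Gball ?GK.
have Xcomplete (u : nat -> X) : cauchy (u @ \oo) -> cvg (u @ \oo).
  exact: cauchy_cvg.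
have hom := G_homogeneous Z_strictly_convex Finj' F_nonexpansive Gball GK
  Xcomplete.
apply: ball_homogeneous_nonexpansive_isometry => //.
- move=> a x a1 Bx; rewrite {1}(FK x Bx).
  by have [_ ->] := hom _ _ (Fball _ Bx) a1.
- move=> x Bx; apply/eqP; rewrite eq_le (Fnorm F_nonexpansive Gball GK)//=.
  rewrite {1}(FK x Bx).
  by have [] := hom _ 0 (Fball _ Bx); rewrite ?normr0.
Qed.
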